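(* Let $\Omega_n=\dfrac{\pi^{n/2}}{\Gamma\left(\frac n2+1\right)}$ for $n\in\mathbb{N}_0$. As $n\to\infty$, the following asymptotic series holds: \[ \ln\frac{\Omega_{n-1}}{\Omega_n}=\frac12\ln\frac{n}{2\pi}+\sum_{j=1}^\infty\frac{\mu_j}{n^j},\qquad \mu_j=(-1)^j\left[B_{j+1}\left(\tfrac12\right)-B_{j+1}(1)\right]\frac{2^j}{j(j+1)}\quad(j\in\mathbb{N}), \] where $B_m(x)$ denote the Bernoulli polynomials.
   Context: $\Omega_n$ is the volume of the unit ball in $\mathbb{R}^n$; $\Gamma$ is Euler's gamma function. The Bernoulli polynomials are defined by $\frac{te^{xt}}{e^t-1}=\sum_{m\ge0}B_m(x)\frac{t^m}{m!}$. The equality with an infinite series is meant as an asymptotic expansion: for every $N$, the difference between the left side and $\frac12\ln\frac n{2\pi}+\sum_{j=1}^N\mu_jn^{-j}$ is $O(n^{-N-1})$ as $n\to\infty$. *)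

(* Defs.v *)
From Stdlib Require Import Reals.
From Coquelicot Require Import Coquelicot.
Open Scope R_scope.

Definition Gamma (x : R) : R :=
  RInt_gen (fun t => Rpower t (x - 1) * exp (- t))
           (at_right 0) (Rbar_locally p_infty).

(* Volume of the unit ball in R^n: Omega_n = pi^(n/2) / Gamma(n/2 + 1). *)
Definition Omega (n : nat) : R :=
  Rpower PI (INR n / 2) / Gamma (INR n / 2 + 1).

(* The generating function t e^(xt) / (e^t - 1), extended by its limit 1 at t = 0. *)
Definition bernoulli_gf (x t : R) : R :=
  if Req_EM_T t 0 then 1 else t * exp (x * t) / (exp t - 1).

(* Bernoulli polynomials via t e^(xt)/(e^t-1) = sum_m B_m(x) t^m / m!,
   i.e. B_m(x) is the m-th derivative at t = 0 of the generating function. *)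
Definition bernoulli_poly (m : nat) (x : R) : R :=
  Derive_n (bernoulli_gf x) m 0.

Definition mu (j : nat) : R :=
  (-1) ^ j * (bernoulli_poly (S j) (1/2) - bernoulli_poly (S j) 1)
  * 2 ^ j / (INR j * INR (S j)).

(* Main.v *)
(* Let [E n] be [ln (Omega (n - 1) / Omega n)] minus its leading term
   [1/2 ln (n / (2 PI))].  From [Gamma (x + 1) = x Gamma x] one gets
   [E n + E (n - 1) = - 1/2 ln (1 - 1/n)], and [Gamma (x + 1/2) <= sqrt x Gamma x]
   gives [E n -> 0].  The difference of the generating functions at [1/2] and [1] is
   [h(t) = - t / (1 + e^(-t/2))], and comparing coefficients in
   [h(t) + h(t) e^(-t/2) = - t] shows that the partial sums [sum_(j <= N) mu j / n^j]
   satisfy the same two-term recurrence up to [O(n^(-N-1))].  Since a null sequence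
   [D] with [D n + D (n - 1) = O(n^(-N-1))] is [O(n^(-N))], the remainder after [N + 1]
   terms is [O(n^(-N-1))], and so is the remainder after [N] terms. *)

Require Import Defs.
From Stdlib Require Import Reals Lra Lia FunctionalExtensionality.
From Coquelicot Require Import Coquelicot.
From mathcomp Require binomial.
Open Scope R_scope.

(** * The Gamma function on [1, oo) *)

Lemma filter_prod_at_right_0_p_infty (P : R * R -> Prop) (a0 b0 : R) :
  0 < a0 -> (forall a b, 0 < a < a0 -> b0 < b -> P (a, b)) ->
  filter_prod (at_right 0) (Rbar_locally p_infty) P.
Proof.
  intros Ha0 HP.
  apply Filter_prod with (fun a => 0 < a < a0) (fun b => b0 < b).
  - exists (mkposreal a0 Ha0); intros y Hy Hy0; split; [exact Hy0|].
    unfold ball in Hy; simpl in Hy.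
    unfold AbsRing_ball, abs, minus, plus, opp in Hy; simpl in Hy.
    apply Rabs_def2 in Hy; lra.
  - exists b0; auto.
  - auto.
Qed.

(** Monotone convergence: since [f >= 0], the integrals over [[a, b]] grow with the interval, so
    they converge to their supremum. *)
Lemma is_RInt_gen_nonneg_bounded (f : R -> R) (M : R) :
  (forall t, 0 < t -> continuous f t) -> (forall t, 0 < t -> 0 <= f t) ->
  (forall a b, 0 < a <= b -> RInt f a b <= M) ->
  exists l, is_RInt_gen f (at_right 0) (Rbar_locally p_infty) l.
Proof.
  intros Hc Hp HM.
  assert (Hex : forall a b, 0 < a -> 0 < b -> ex_RInt f a b).
  { intros a b Ha Hb; apply (ex_RInt_continuous (V := R_CompleteNormedModule)).
    intros z [Hz _]; apply Hc; revert Hz; unfold Rmin; destruct Rle_dec; lra. }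
  set (E := fun y => exists a b, 0 < a <= b /\ y = RInt f a b).
  destruct (completeness E) as [l [Hub Hlub]].
  { exists M; intros y (a & b & Hab & ->); auto. }
  { exists (RInt f 1 1), 1, 1; split; [lra|reflexivity]. }
  exists l; intros P [eps HP].
  assert (exists y, E y /\ l - eps < y) as (y & (a0 & b0 & Hab & ->) & Hy).
  { apply Classical_Prop.NNPP; intro Hn.
    assert (l <= l - eps); [|destruct eps; simpl in *; lra].
    apply Hlub; intros y Hy; apply Rnot_lt_le; intro; apply Hn; eauto. }
  apply filter_prod_at_right_0_p_infty with a0 b0; [lra|].
  intros a b Ha Hb; exists (RInt f a b); simpl; split.
  { apply (RInt_correct (V := R_CompleteNormedModule)), Hex; lra. }
  apply HP; unfold ball; simpl; unfold AbsRing_ball, abs, minus, plus, opp; simpl.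
  assert (RInt f a b <= l) by (apply Hub; exists a, b; split; [lra|reflexivity]).
  assert (RInt f a0 b0 <= RInt f a b).
  { rewrite <- (RInt_Chasles f a b0 b), <- (RInt_Chasles f a a0 b0) by (apply Hex; lra).
    assert (0 <= RInt f a a0) by (apply RInt_ge_0; [lra|apply Hex; lra|intros; apply Hp; lra]).
    assert (0 <= RInt f b0 b) by (apply RInt_ge_0; [lra|apply Hex; lra|intros; apply Hp; lra]).
    unfold plus; simpl; lra. }
  apply Rabs_def1; lra.
Qed.

Definition Gamma_integrand (x t : R) : R := Rpower t (x - 1) * exp (- t).

Lemma Gamma_integrand_pos (x t : R) : 0 < Gamma_integrand x t.
Proof. apply Rmult_lt_0_compat; apply exp_pos. Qed.

Lemma Gamma_integrand_continuous (x t : R) :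
  0 < t -> continuous (Gamma_integrand x) t.
Proof.
  intro Ht; apply (ex_derive_continuous (V := R_NormedModule)).
  unfold Gamma_integrand, Rpower; auto_derive; exact Ht.
Qed.

(* Since [ln s <= s - 1] at [s = t / (2 y)]. *)
Lemma Rpower_exp_bound (y t : R) :
  0 < y -> 0 < t ->
  Rpower t y * exp (- t) <= exp (y * ln (2 * y) - y) * exp (- t / 2).
Proof.
  intros Hy Ht; unfold Rpower; rewrite <- !exp_plus.
  assert (Hs : 0 < t / (2 * y)) by (apply Rdiv_lt_0_compat; lra).
  assert (Hl : ln (t / (2 * y)) <= t / (2 * y) - 1).
  { pose proof (exp_ineq1_le (ln (t / (2 * y)))) as H.
    rewrite exp_ln in H by exact Hs; lra. }
  rewrite ln_div in Hl by lra.
  apply (Rmult_le_compat_l y) in Hl; [|lra].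
  replace (y * (t / (2 * y) - 1)) with (t / 2 - y) in Hl by (field; lra).
  assert (H : y * ln t + - t <= y * ln (2 * y) - y + - t / 2) by lra.
  destruct H as [H| ->]; [left; apply exp_increasing, H|right; reflexivity].
Qed.

Lemma Gamma_integrand_bound (x : R) :
  1 <= x -> exists K, 0 < K /\
    forall t, 0 < t -> Gamma_integrand x t <= K * exp (- t / 2).
Proof.
  intros [Hx| <-].
  - exists (exp ((x - 1) * ln (2 * (x - 1)) - (x - 1))); split; [apply exp_pos|].
    intros t Ht; apply Rpower_exp_bound; lra.
  (* At [x = 1] the exponent is 0, which [Rpower_exp_bound] excludes; the integrand is then just
     [e^(-t)]. *)
  - exists 1; split; [lra|]; intros t Ht; unfold Gamma_integrand, Rpower.
    replace (1 - 1) with 0 by ring; rewrite Rmult_0_l, exp_0, !Rmult_1_l.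
    left; apply exp_increasing; lra.
Qed.

(** Gives [Gamma x] its meaning as a convergent integral: the integrand is dominated by
    [K e^(-t/2)], whose integral is at most [2 K]. For [x >= 1] the singularity at 0 does not arise,
    and the arguments [n/2 + 1] lie in this range. *)
Lemma is_RInt_gen_Gamma (x : R) :
  1 <= x ->
  is_RInt_gen (Gamma_integrand x) (at_right 0) (Rbar_locally p_infty) (Gamma x).
Proof.
  intro Hx; apply (RInt_gen_correct (V := R_CompleteNormedModule)).
  destruct (Gamma_integrand_bound x Hx) as (K & HK & Hb).
  destruct (is_RInt_gen_nonneg_bounded (Gamma_integrand x) (2 * K)) as [l Hl].
  - apply Gamma_integrand_continuous.
  - intros; left; apply Gamma_integrand_pos.
  - intros a b Hab.
    assert (Hi : is_RInt (fun t => K * exp (- t / 2)) a b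
                   (-2 * K * exp (- b / 2) - -2 * K * exp (- a / 2))).
    { apply (is_RInt_derive (V := R_CompleteNormedModule) (fun t => -2 * K * exp (- t / 2))).
      - intros t _; auto_derive; [exact I|unfold Rdiv; field].
      - intros t _; apply (ex_derive_continuous (V := R_NormedModule)).
        auto_derive; exact I. }
    apply Rle_trans with (RInt (fun t => K * exp (- t / 2)) a b).
    + apply RInt_le; [lra| |eexists; exact Hi|intros; apply Hb; lra].
      apply (ex_RInt_continuous (V := R_CompleteNormedModule)); intros z [Hz _].
      apply Gamma_integrand_continuous; revert Hz; unfold Rmin; destruct Rle_dec; lra.
    + rewrite (is_RInt_unique _ _ _ _ Hi).
      pose proof (exp_pos (- b / 2)).
      assert (exp (- a / 2) < 1) by (rewrite <- exp_0; apply exp_increasing; lra).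
      nra.
  - exists l; exact Hl.
Qed.

(** Monotonicity of the improper integral is read off the norm inequality: [f] is its own norm, so
    [lf <= |lf| <= lg]. *)
Lemma RInt_gen_Gamma_le (f g : R -> R) (lf lg : R) :
  (forall t, 0 < t -> 0 <= f t <= g t) ->
  is_RInt_gen f (at_right 0) (Rbar_locally p_infty) lf ->
  is_RInt_gen g (at_right 0) (Rbar_locally p_infty) lg -> lf <= lg.
Proof.
  intros H Hf Hg; apply Rle_trans with (norm lf); [apply Rle_abs|].
  refine (RInt_gen_norm (V := R_CompleteNormedModule) f g lf lg _ _ Hf Hg);
    apply filter_prod_at_right_0_p_infty with 1 1; try exact Rlt_0_1; simpl.
  - intros a b Ha Hb; lra.
  - intros a b Ha Hb t Ht; destruct (H t); [lra|].
    unfold norm; simpl; unfold abs; simpl; rewrite Rabs_pos_eq; lra.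
Qed.

Lemma Gamma_pos (x : R) : 1 <= x -> 0 < Gamma x.
Proof.
  intro Hx.
  assert (Hex : forall a b, 0 < a -> 0 < b -> ex_RInt (Gamma_integrand x) a b).
  { intros a b Ha Hb; apply (ex_RInt_continuous (V := R_CompleteNormedModule)).
    intros z [Hz _]; apply Gamma_integrand_continuous.
    revert Hz; unfold Rmin; destruct Rle_dec; lra. }
  assert (Hp : 0 < RInt (Gamma_integrand x) 1 2).
  { apply RInt_gt_0; [lra| |]; intros; [apply Gamma_integrand_pos|].
    apply Gamma_integrand_continuous; lra. }
  apply Rlt_le_trans with (1 := Hp).
  (* If the limit were below the integral over [[1, 2]], so would be the integral over some larger
     interval [[a, c]], against the positivity of the integrand. *)
  apply Rnot_lt_le; intro Hlt.
  destruct (is_RInt_gen_Gamma x Hx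
    (fun y => y < RInt (Gamma_integrand x) 1 2)) as [Q S HQ [b HS] Hint].
  { apply (open_lt (RInt (Gamma_integrand x) 1 2)); exact Hlt. }
  destruct HQ as [eps HQ].
  set (a := Rmin (eps / 2) 1).
  assert (Ha : 0 < a /\ a < eps /\ a <= 1).
  { destruct eps as [e He]; unfold a, Rmin; simpl; destruct Rle_dec; simpl in *; lra. }
  set (c := Rmax (b + 1) 2).
  assert (Hc : b < c /\ 2 <= c) by (unfold c, Rmax; destruct Rle_dec; lra).
  destruct (Hint a c) as (y & Hy & Hy').
  - apply HQ; [|lra]; unfold ball; simpl; unfold AbsRing_ball, abs, minus, plus, opp; simpl.
    apply Rabs_def1; lra.
  - apply HS; lra.
  - apply (is_RInt_unique (V := R_CompleteNormedModule)) in Hy; simpl in Hy; subst y.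
    rewrite <- (RInt_Chasles (Gamma_integrand x) a 2 c),
      <- (RInt_Chasles (Gamma_integrand x) a 1 2) in Hy' by (apply Hex; lra).
    assert (0 <= RInt (Gamma_integrand x) a 1)
      by (apply RInt_ge_0; [lra|apply Hex; lra|intros; left; apply Gamma_integrand_pos]).
    assert (0 <= RInt (Gamma_integrand x) 2 c)
      by (apply RInt_ge_0; [lra|apply Hex; lra|intros; left; apply Gamma_integrand_pos]).
    unfold plus in Hy'; simpl in Hy'; lra.
Qed.

(** Boundary term at 0 of the integration by parts in [Gamma_succ]: for [t < 1] and [x >= 1] one has
    [t^x <= t]. *)
Lemma Rpower_exp_lim_0 (x : R) :
  1 <= x -> filterlim (fun t => Rpower t x * exp (- t)) (at_right 0) (locally 0).
Proof.
  intros Hx P [eps HP].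
  assert (He : 0 < Rmin eps 1) by (destruct eps; unfold Rmin; destruct Rle_dec; simpl; lra).
  exists (mkposreal _ He); intros t Ht Ht0; apply HP.
  unfold ball in *; simpl in *; unfold AbsRing_ball, abs, minus, plus, opp in *; simpl in *.
  apply Rabs_def2 in Ht.
  assert (t < eps /\ t < 1) by (revert Ht; unfold Rmin; destruct Rle_dec; lra).
  pose proof (exp_pos (x * ln t)); pose proof (exp_pos (- t)).
  assert (exp (- t) < 1) by (rewrite <- exp_0; apply exp_increasing; lra).
  assert (exp (x * ln t) <= t).
  { rewrite <- (exp_ln t) at 2 by lra.
    assert (ln t < 0) by (rewrite <- ln_1; apply ln_increasing; lra).
    destruct (Req_dec x 1) as [-> |]; [rewrite Rmult_1_l; lra|].
    left; apply exp_increasing; nra. }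
  unfold Rpower; apply Rabs_def1; nra.
Qed.

Lemma Rpower_exp_lim_p_infty (x : R) :
  1 <= x -> filterlim (fun t => Rpower t x * exp (- t)) (Rbar_locally p_infty) (locally 0).
Proof.
  intro Hx.
  set (K := exp (x * ln (2 * x) - x)).
  change (is_lim (fun t => Rpower t x * exp (- t)) p_infty 0).
  apply (is_lim_le_le_loc (fun _ => 0) (fun t => K * exp (- t / 2))).
  - exists 0; intros t Ht; split.
    + left; apply Rmult_lt_0_compat; apply exp_pos.
    + apply Rpower_exp_bound; lra.
  - apply is_lim_const.
  - replace (Finite 0) with (Rbar_mult K 0) by (simpl; f_equal; ring).
    apply is_lim_scal_l.
    apply (is_lim_comp exp (fun t => - t / 2) p_infty 0 m_infty).
    + apply is_lim_exp_m.
    + apply is_lim_ext with (fun t => (- / 2) * t); [intros; field|].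
      replace m_infty with (Rbar_mult (- / 2) p_infty).
      * apply is_lim_scal_l, is_lim_id.
      * simpl; destruct Rle_dec as [Hle|_]; [exfalso; lra|reflexivity].
    + exists 0; intros; discriminate.
Qed.

(** Integration by parts, in the form that [F(t) = t^x e^(-t)] vanishes at both ends while [F'] is
    the difference of the two integrands. *)
Lemma Gamma_succ (x : R) : 1 <= x -> Gamma (x + 1) = x * Gamma x.
Proof.
  intro Hx; symmetry.
  set (F := fun t => Rpower t x * exp (- t)).
  assert (HF : forall t, 0 < t ->
    is_derive F t (x * Gamma_integrand x t - Gamma_integrand (x + 1) t)).
  { intros t Ht; unfold F, Gamma_integrand.
    replace (x + 1 - 1) with x by ring.
    replace (Rpower t (x - 1)) with (Rpower t x / t).
    - unfold Rpower; auto_derive; [exact Ht|field; lra].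
    - unfold Rminus; rewrite Rpower_plus, Rpower_Ropp, Rpower_1 by exact Ht; reflexivity. }
  assert (Hpos : forall a b t : R, 0 < a < 1 -> 1 < b -> Rmin a b <= t -> 0 < t)
    by (intros a b t; unfold Rmin; destruct Rle_dec; lra).
  assert (H1 : is_RInt_gen (Derive F) (at_right 0) (Rbar_locally p_infty) (0 - 0)).
  { apply is_RInt_gen_Derive.
    - apply filter_prod_at_right_0_p_infty with 1 1; simpl; [lra|].
      intros a b Ha Hb t [Ht _]; eexists; apply HF; eauto.
    - apply filter_prod_at_right_0_p_infty with 1 1; simpl; [lra|].
      intros a b Ha Hb t [Ht _].
      assert (Ht0 : 0 < t) by eauto.
      (* The formula for [F'] is available only on [(0, oo)], so continuity is transferred on a
         neighbourhood of [t] inside that half-line. *)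
      apply continuous_ext_loc with
        (fun t => x * Gamma_integrand x t - Gamma_integrand (x + 1) t).
      + exists (mkposreal t Ht0); intros y Hy; symmetry; apply is_derive_unique, HF.
        unfold ball in Hy; simpl in Hy.
        unfold AbsRing_ball, abs, minus, plus, opp in Hy; simpl in Hy.
        apply Rabs_def2 in Hy; lra.
      + apply (ex_derive_continuous (V := R_NormedModule)).
        unfold Gamma_integrand, Rpower; auto_derive; tauto.
    - apply Rpower_exp_lim_0, Hx.
    - apply Rpower_exp_lim_p_infty, Hx. }
  apply (is_RInt_gen_ext _
    (fun t => minus (scal x (Gamma_integrand x t)) (Gamma_integrand (x + 1) t))) in H1.
  - assert (H2 : is_RInt_gen (fun t => minus (scal x (Gamma_integrand x t))
        (Gamma_integrand (x + 1) t)) (at_right 0) (Rbar_locally p_infty)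
        (minus (scal x (Gamma x)) (Gamma (x + 1)))).
    { apply (is_RInt_gen_minus (V := R_NormedModule)).
      - apply (is_RInt_gen_scal (V := R_NormedModule)), is_RInt_gen_Gamma, Hx.
      - apply is_RInt_gen_Gamma; lra. }
    apply (is_RInt_gen_unique (V := R_CompleteNormedModule)) in H1.
    apply (is_RInt_gen_unique (V := R_CompleteNormedModule)) in H2.
    rewrite H1 in H2; unfold minus, plus, opp, scal in H2; simpl in H2.
    unfold mult in H2; simpl in H2; lra.
  - apply filter_prod_at_right_0_p_infty with 1 1; simpl; [lra|].
    intros a b Ha Hb t [Ht _]; apply is_derive_unique, HF.
    apply (Hpos a b); lra.
Qed.

(* AM-GM: [2 sqrt x t^(1/2) <= x + t] under the integral sign, together with
   [Gamma (x + 1) = x * Gamma x]. *)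
Lemma Gamma_half_le (x : R) : 1 <= x -> Gamma (x + 1 / 2) <= sqrt x * Gamma x.
Proof.
  intro Hx.
  pose proof (sqrt_lt_R0 x ltac:(lra)) as Hs.
  pose proof (sqrt_sqrt x ltac:(lra)) as Hss.
  assert (H : 2 * sqrt x * Gamma (x + 1 / 2) <= x * Gamma x + Gamma (x + 1)).
  { apply RInt_gen_Gamma_le with (fun t => scal (2 * sqrt x) (Gamma_integrand (x + 1 / 2) t))
      (fun t => plus (scal x (Gamma_integrand x t)) (Gamma_integrand (x + 1) t)).
    - intros t Ht; unfold plus, scal; simpl; unfold mult; simpl.
      pose proof (Gamma_integrand_pos (x + 1 / 2) t).
      split; [nra|].
      unfold Gamma_integrand.
      replace (x + 1 / 2 - 1) with (x - 1 + / 2) by field.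
      replace (x + 1 - 1) with (x - 1 + 1) by ring.
      rewrite !(Rpower_plus (x - 1)), Rpower_sqrt, Rpower_1 by exact Ht.
      pose proof (sqrt_sqrt t ltac:(lra)) as Htt.
      assert (0 < Rpower t (x - 1) * exp (- t)) by (apply Rmult_lt_0_compat; apply exp_pos).
      assert (Hsq : 0 <= (Rpower t (x - 1) * exp (- t)) * (sqrt x - sqrt t) ^ 2)
        by (apply Rmult_le_pos; [lra|apply pow2_ge_0]).
      replace ((sqrt x - sqrt t) ^ 2)
        with (sqrt x * sqrt x + sqrt t * sqrt t - 2 * sqrt x * sqrt t) in Hsq by ring.
      rewrite Hss, Htt in Hsq; lra.
    - apply (is_RInt_gen_scal (V := R_NormedModule)), is_RInt_gen_Gamma; lra.
    - apply (is_RInt_gen_plus (V := R_NormedModule)).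
      + apply (is_RInt_gen_scal (V := R_NormedModule)), is_RInt_gen_Gamma; lra.
      + apply is_RInt_gen_Gamma; lra. }
  rewrite Gamma_succ in H by exact Hx.
  apply Rmult_le_reg_l with (2 * sqrt x); [lra|].
  replace (2 * sqrt x * (sqrt x * Gamma x)) with (2 * (sqrt x * sqrt x) * Gamma x) by ring.
  rewrite Hss; lra.
Qed.


(** * Smooth functions and Bernoulli polynomials *)

(** Peeling off the first derivative makes closure under sums, products and inverses a direct
    induction on [k]. Continuity of the last derivative is not demanded. *)
Fixpoint Ck (k : nat) (f : R -> R) : Prop :=
  match k with
  | O => True
  | S k => (forall t, ex_derive f t) /\ Ck k (Derive f)
  end.

Definition smooth (f : R -> R) : Prop := forall k, Ck k f.

Lemma smooth_ex_derive (f : R -> R) (t : R) : smooth f -> ex_derive f t.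
Proof. intro H; apply (H 1%nat). Qed.

Lemma smooth_Derive (f : R -> R) : smooth f -> smooth (Derive f).
Proof. intros H k; apply (H (S k)). Qed.

Lemma smooth_ex_derive_n (f : R -> R) (n : nat) (t : R) :
  smooth f -> ex_derive_n f n t.
Proof.
  intro Hf; destruct n as [|n]; [exact I|]; simpl.
  assert (H : smooth (Derive_n f n)); [|apply smooth_ex_derive, H].
  induction n as [|n IH]; [exact Hf|apply smooth_Derive, IH].
Qed.

Lemma Derive_n_Derive (f : R -> R) (n : nat) (t : R) :
  Derive_n (Derive f) n t = Derive_n f (S n) t.
Proof.
  replace (S n) with (n + 1)%nat by lia; exact (Derive_n_comp f n 1 t).
Qed.

Lemma ex_derive_n_smooth (f : R -> R) : (forall n t, ex_derive_n f n t) -> smooth f.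
Proof.
  intros H k; revert f H; induction k as [|k IH]; intros f H; [exact I|split].
  - apply (H 1%nat).
  - apply IH; intros [|n] t; [exact I|].
    apply ex_derive_ext with (Derive_n f (S n)); [|apply (H (S (S n)))].
    intro s; symmetry; apply Derive_n_Derive.
Qed.

Lemma Ck_pred (k : nat) (f : R -> R) : Ck (S k) f -> Ck k f.
Proof.
  revert f; induction k as [|k IH]; intros f H; [exact I|].
  destruct H as [H1 H2]; split; [exact H1|apply IH, H2].
Qed.

Lemma Ck_plus (k : nat) (f g : R -> R) :
  Ck k f -> Ck k g -> Ck k (fun t => f t + g t).
Proof.
  revert f g; induction k as [|k IH]; intros f g Hf Hg; [exact I|].
  destruct Hf as [Hf Hf'], Hg as [Hg Hg']; split.
  - intro t; apply (ex_derive_plus (V := R_NormedModule)); auto.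
  - replace (Derive (fun t => f t + g t)) with (fun t => Derive f t + Derive g t).
    + auto.
    + extensionality t; symmetry; apply Derive_plus; auto.
Qed.

Lemma Ck_mult (k : nat) (f g : R -> R) :
  Ck k f -> Ck k g -> Ck k (fun t => f t * g t).
Proof.
  revert f g; induction k as [|k IH]; intros f g Hf Hg; [exact I|].
  pose proof (Ck_pred _ _ Hf); pose proof (Ck_pred _ _ Hg).
  destruct Hf as [Hf Hf'], Hg as [Hg Hg']; split.
  - intro t; apply ex_derive_mult; auto.
  - replace (Derive (fun t => f t * g t))
      with (fun t => Derive f t * g t + f t * Derive g t).
    + apply Ck_plus; auto.
    + extensionality t; symmetry; apply Derive_mult; auto.
Qed.

Lemma Ck_const (k : nat) (c : R) : Ck k (fun _ => c).
Proof.
  revert c; induction k as [|k IH]; intro c; [exact I|split].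
  - intro t; apply ex_derive_const.
  - replace (Derive (fun _ => c)) with (fun _ : R => 0); [apply IH|].
    extensionality t; symmetry; apply Derive_const.
Qed.

(** Since [(1/f)' = - f' (1/f)^2], the derivative involves only [f'] and [1/f] itself, to which the
    induction hypothesis applies. *)
Lemma Ck_inv (k : nat) (f : R -> R) :
  (forall t, f t <> 0) -> Ck k f -> Ck k (fun t => / f t).
Proof.
  intro H0; induction k as [|k IH]; intro Hf; [exact I|].
  pose proof (Ck_pred _ _ Hf) as Hk.
  destruct Hf as [Hf Hf']; split.
  - intro t; apply ex_derive_inv; auto.
  - replace (Derive (fun t => / f t))
      with (fun t => -1 * Derive f t * (/ f t * / f t)).
    + apply Ck_mult; apply Ck_mult; auto using Ck_const.
    + extensionality t; rewrite Derive_inv by auto; field; apply H0.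
Qed.

Lemma smooth_exp_scal (a : R) : smooth (fun t => exp (a * t)).
Proof.
  intro k; induction k as [|k IH]; [exact I|split].
  - intro t; auto_derive; exact I.
  - replace (Derive (fun t => exp (a * t))) with (fun t => a * exp (a * t)).
    + apply Ck_mult; [apply Ck_const|exact IH].
    + extensionality t; symmetry; apply is_derive_unique; auto_derive; [exact I|ring].
Qed.

(** This is [(e^t - 1) / t] with its value 1 at 0, written as the shifted exponential series so that
    smoothness at 0 comes from the infinite radius of convergence. *)
Definition exp_slope (t : R) : R :=
  PSeries (PS_decr_1 (fun n => / INR (Factorial.fact n))) t.

Lemma is_lim_seq_inv_INR : is_lim_seq (fun n => / INR n) 0.
Proof.
  replace (Finite 0) with (Rbar_inv p_infty) by reflexivity.
  apply is_lim_seq_inv; [apply is_lim_seq_INR|discriminate].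
Qed.

Lemma CV_radius_exp : CV_radius (fun n => / INR (Factorial.fact n)) = p_infty.
Proof.
  apply CV_radius_infinite_DAlembert.
  - intro n; apply Rinv_neq_0_compat, INR_fact_neq_0.
  - apply is_lim_seq_ext with (fun n => / INR (S n)).
    + intro n; rewrite fact_simpl, mult_INR.
      pose proof (lt_0_INR (S n) ltac:(lia)); pose proof (INR_fact_lt_0 n).
      replace (_ / _) with (/ INR (S n)) by (field; lra).
      symmetry; apply Rabs_pos_eq; left; apply Rinv_0_lt_compat; lra.
    + apply (is_lim_seq_incr_1 (fun n => / INR n)), is_lim_seq_inv_INR.
Qed.

Lemma smooth_exp_slope : smooth exp_slope.
Proof.
  apply ex_derive_n_smooth; intros n t; apply ex_derive_n_PSeries.
  rewrite CV_radius_decr_1, CV_radius_exp; exact I.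
Qed.

Lemma exp_slope_eq (t : R) : exp t = 1 + t * exp_slope t.
Proof.
  pose proof (is_exp_Reals t) as H.
  rewrite <- (is_pseries_unique _ _ _ H), PSeries_decr_1 by (eexists; exact H).
  simpl; unfold exp_slope; lra.
Qed.

Lemma exp_slope_0 : exp_slope 0 = 1.
Proof.
  unfold exp_slope; rewrite PSeries_0; unfold PS_decr_1; simpl; lra.
Qed.

Lemma exp_slope_neq_0 (t : R) : exp_slope t <> 0.
Proof.
  destruct (Req_dec t 0) as [-> |Ht]; [rewrite exp_slope_0; lra|].
  intro H; apply Ht, exp_inv; rewrite exp_0, exp_slope_eq, H; ring.
Qed.

(** Removes the case distinction at [t = 0], leaving a product of smooth functions. *)
Lemma bernoulli_gf_exp_slope (x : R) :
  bernoulli_gf x = fun t => exp (x * t) * / exp_slope t.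
Proof.
  extensionality t; unfold bernoulli_gf; destruct Req_EM_T as [-> |Ht].
  - rewrite exp_slope_0, Rmult_0_r, exp_0; field.
  - rewrite (exp_slope_eq t).
    pose proof (exp_slope_neq_0 t); field; split; [exact H|].
    replace (1 + t * exp_slope t - 1) with (t * exp_slope t) by ring.
    apply Rmult_integral_contrapositive_currified; auto.
Qed.

Lemma smooth_bernoulli_gf (x : R) : smooth (bernoulli_gf x).
Proof.
  rewrite bernoulli_gf_exp_slope; intro k; apply Ck_mult.
  - apply smooth_exp_scal.
  - apply Ck_inv; [apply exp_slope_neq_0|apply smooth_exp_slope].
Qed.

Lemma Derive_n_plus_smooth (f g : R -> R) (n : nat) (t : R) : smooth f -> smooth g ->
  Derive_n (fun s => f s + g s) n t = Derive_n f n t + Derive_n g n t.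
Proof.
  intros Hf Hg; apply Derive_n_plus; exists (mkposreal 1 Rlt_0_1);
    intros; apply smooth_ex_derive_n; assumption.
Qed.

(** * Binomial transforms and the Leibniz rule *)

Definition binom (n k : nat) : R := INR (binomial.binomial n k).

Lemma binom_S (n k : nat) : binom (S n) (S k) = binom n (S k) + binom n k.
Proof. exact (plus_INR (binomial.binomial n (S k)) (binomial.binomial n k)). Qed.

Lemma binom_0 (n : nat) : binom n 0 = 1.
Proof. unfold binom; rewrite binomial.bin0; reflexivity. Qed.

Lemma binom_small (n k : nat) : (n < k)%nat -> binom n k = 0.
Proof.
  intro H; unfold binom; rewrite binomial.bin_small; [reflexivity|].
  apply (ssrbool.introT ssrnat.leP); exact H.
Qed.

Lemma binom_absorb (n k : nat) : INR (S n) * binom n k = INR (S k) * binom (S n) (S k).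
Proof.
  unfold binom; rewrite <- !mult_INR; f_equal; exact (binomial.mul_bin_diag (S n) k).
Qed.

(** Pascal's rule splits the transform into those of [x] and of its shift. The first sum may run to
    [n + 1], as [binom n (S n) = 0]. *)
Lemma binom_transform_S (x : nat -> R) (n : nat) :
  sum_n (fun k => binom (S n) k * x k) (S n) =
  sum_n (fun k => binom n k * x k) n + sum_n (fun k => binom n k * x (S k)) n.
Proof.
  unfold sum_n; rewrite sum_Sn_m, <- sum_n_m_S by lia.
  replace (sum_n_m (fun k => binom n k * x k) 0 n)
    with (sum_n_m (fun k => binom n k * x k) 0 (S n)).
  - rewrite (sum_Sn_m (fun k => binom n k * x k)), <- sum_n_m_S by lia.
    rewrite (sum_n_m_ext (fun k => binom (S n) (S k) * x (S k))
      (fun k => plus (binom n (S k) * x (S k)) (binom n k * x (S k)))).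
    + rewrite sum_n_m_plus, !binom_0; unfold plus; simpl; ring.
    + intro k; rewrite binom_S; unfold plus; simpl; ring.
  - rewrite sum_n_Sm by lia; rewrite (binom_small n (S n)) by lia.
    unfold plus; simpl; ring.
Qed.

Lemma sum_n_m_scal_ext (c : R) (u v : nat -> R) (a b : nat) :
  (forall k, u k = c * v k) -> sum_n_m u a b = c * sum_n_m v a b.
Proof.
  intro H; rewrite <- (sum_n_m_mult_l (K := R_Ring) c); apply sum_n_m_ext, H.
Qed.

(* Leibniz' rule for [f(t) e^(t/b)], by iterating [(f e^(t/b))' = (f' + f/b) e^(t/b)]. *)
Lemma Derive_n_mult_exp (b : R) (n : nat) (f : R -> R) : b <> 0 -> smooth f ->
  b ^ n * Derive_n (fun t => f t * exp (/ b * t)) n 0 =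
  sum_n (fun k => binom n k * (b ^ k * Derive_n f k 0)) n.
Proof.
  intro Hb; revert f; induction n as [|n IH]; intros f Hf.
  - rewrite sum_O, binom_0; simpl; rewrite Rmult_0_r, exp_0; ring.
  - rewrite binom_transform_S, <- (IH f Hf).
    unfold sum_n; rewrite (sum_n_m_scal_ext b (fun k => binom n k * (b ^ S k * Derive_n f (S k) 0))
      (fun k => binom n k * (b ^ k * Derive_n (Derive f) k 0))).
    + fold (sum_n (fun k => binom n k * (b ^ k * Derive_n (Derive f) k 0)) n).
      rewrite <- (IH (Derive f)) by (apply smooth_Derive, Hf).
      rewrite <- Derive_n_Derive.
      replace (Derive (fun t => f t * exp (/ b * t)))
        with (fun t => Derive f t * exp (/ b * t) + / b * (f t * exp (/ b * t))).
      * rewrite Derive_n_plus_smooth, Derive_n_scal_l.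
        -- rewrite <- tech_pow_Rmult; field; exact Hb.
        -- intro k; apply Ck_mult; [apply smooth_Derive, Hf|apply smooth_exp_scal].
        -- intro k; apply Ck_mult; [apply Ck_const|].
           apply Ck_mult; [apply Hf|apply smooth_exp_scal].
      * extensionality t; symmetry.
        rewrite (Derive_mult f (fun t => exp (/ b * t)));
          [|apply smooth_ex_derive, Hf|auto_derive; exact I].
        replace (Derive (fun t => exp (/ b * t)) t) with (/ b * exp (/ b * t)); [ring|].
        symmetry; apply is_derive_unique; auto_derive; [exact I|ring].
    + intro k; 
      rewrite Derive_n_Derive; simpl; ring.
Qed.

(** * Differences of Bernoulli polynomials and the recurrence for [mu] *)

Definition bernoulli_diff (m : nat) : R :=
  (-2) ^ m * (bernoulli_poly m (1 / 2) - bernoulli_poly m 1).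

Definition gf_diff (t : R) : R := bernoulli_gf (1 / 2) t + -1 * bernoulli_gf 1 t.

Lemma smooth_gf_diff : smooth gf_diff.
Proof.
  intro k; apply Ck_plus; [|apply Ck_mult; [apply Ck_const|]]; apply smooth_bernoulli_gf.
Qed.

(** Because of the factor [(-2)^m] these are the derivatives at 0 of [gf_diff (-2 t)]. In this
    scaling the factor [e^(-t/2)] becomes [e^t] and acts on the coefficients as the plain binomial
    transform. *)
Lemma bernoulli_diff_Derive_n (m : nat) :
  bernoulli_diff m = (-2) ^ m * Derive_n gf_diff m 0.
Proof.
  unfold bernoulli_diff, gf_diff, bernoulli_poly.
  rewrite Derive_n_plus_smooth, Derive_n_scal_l; [ring|apply smooth_bernoulli_gf|].
  intro k; apply Ck_mult; [apply Ck_const|apply smooth_bernoulli_gf].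
Qed.

(* The factor [e^(t/2) - 1] cancels:
   [gf_diff t = - t e^(t/2) / (e^(t/2) + 1) = - t / (1 + e^(-t/2))]. *)
Lemma gf_diff_eq (t : R) : gf_diff t + gf_diff t * exp (/ -2 * t) = - t.
Proof.
  unfold gf_diff, bernoulli_gf; destruct Req_EM_T as [-> |Ht]; [ring|].
  set (e := exp (1 / 2 * t)).
  assert (He : 0 < e) by apply exp_pos.
  assert (H1 : exp (1 * t) = e * e) by (unfold e; rewrite <- exp_plus; f_equal; field).
  assert (H2 : exp t = e * e) by (unfold e; rewrite <- exp_plus; f_equal; field).
  assert (H3 : exp (/ -2 * t) = / e) by (unfold e; rewrite <- exp_Ropp; f_equal; field).
  rewrite H1, H2, H3; field; split; [lra|].
  intro H; apply Ht, exp_inv; rewrite exp_0, H2; lra.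
Qed.

(** Takes the [n]-th derivative at 0 of [gf_diff_eq], using [Derive_n_mult_exp] with [b = -2]. *)
Lemma bernoulli_diff_rec (n : nat) :
  bernoulli_diff n + sum_n (fun k => binom n k * bernoulli_diff k) n =
  (-2) ^ n * Derive_n (fun t => - t) n 0.
Proof.
  rewrite bernoulli_diff_Derive_n.
  rewrite (sum_n_ext _ (fun k => binom n k * ((-2) ^ k * Derive_n gf_diff k 0)))
    by (intro; rewrite bernoulli_diff_Derive_n; reflexivity).
  rewrite <- Derive_n_mult_exp; [|lra|apply smooth_gf_diff].
  rewrite <- Rmult_plus_distr_l, <- Derive_n_plus_smooth.
  - f_equal; apply Derive_n_ext, gf_diff_eq.
  - apply smooth_gf_diff.
  - intro k; apply Ck_mult; [apply smooth_gf_diff|apply smooth_exp_scal].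
Qed.

Lemma Derive_n_opp_id (n : nat) (t : R) :
  Derive_n (fun t => - t) n t = match n with 0%nat => - t | 1%nat => -1 | _ => 0 end.
Proof.
  revert t; induction n as [|n IH]; intro t; [reflexivity|].
  simpl; rewrite (Derive_ext _ _ t IH).
  destruct n as [|[|n]]; try apply Derive_const.
  apply is_derive_unique; auto_derive; [exact I|ring].
Qed.

Lemma bernoulli_diff_0 : bernoulli_diff 0 = 0.
Proof.
  pose proof (bernoulli_diff_rec 0) as H.
  rewrite sum_O, binom_0, Derive_n_opp_id in H; simpl in H; lra.
Qed.

Lemma bernoulli_diff_1 : bernoulli_diff 1 = 1.
Proof.
  pose proof (bernoulli_diff_rec 1) as H.
  rewrite sum_Sn, sum_O, binom_0, binom_S, binom_0, (binom_small 0 1),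
    bernoulli_diff_0, Derive_n_opp_id in H by lia.
  unfold plus in H; simpl in H; lra.
Qed.

Lemma mu_bernoulli_diff (j : nat) :
  mu (S j) = - bernoulli_diff (S (S j)) / (2 * (INR (S j) * INR (S (S j)))).
Proof.
  unfold mu, bernoulli_diff.
  pose proof (lt_0_INR (S j) ltac:(lia)); pose proof (lt_0_INR (S (S j)) ltac:(lia)).
  replace (-2) with (-1 * 2) by ring; rewrite Rpow_mult_distr.
  rewrite <- !tech_pow_Rmult; field; lra.
Qed.

(** This is [bernoulli_diff_rec] at [k + 2] divided by [-2 (k + 1) (k + 2)]; its terms of index 0
    and 1 are 0 and [k + 2], and the latter gives the right side. That right side is the coefficient
    of [u^(k+1)] in [- 1/2 ln (1 - u)]. *)
Lemma mu_rec (k : nat) :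
  mu (S k) + sum_n (fun j => binom k j * mu (S j)) k = / (2 * INR (S k)).
Proof.
  pose proof (lt_0_INR (S k) ltac:(lia)) as H1.
  pose proof (lt_0_INR (S (S k)) ltac:(lia)) as H2.
  pose proof (bernoulli_diff_rec (S (S k))) as H.
  rewrite Derive_n_opp_id, Rmult_0_r in H.
  unfold sum_n in H; rewrite sum_Sn_m, sum_Sn_m, <- !sum_n_m_S in H by lia.
  rewrite bernoulli_diff_0, bernoulli_diff_1 in H.
  rewrite (sum_n_m_scal_ext (-2 * (INR (S k) * INR (S (S k)))) _
    (fun j => binom k j * mu (S j))) in H.
  - assert (Hb : binom (S (S k)) 1 = INR (S (S k))).
    { pose proof (binom_absorb (S k) 0) as Hb.
      rewrite binom_0 in Hb; simpl INR in Hb at 2; lra. }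
    set (S0 := sum_n (fun j => binom k j * mu (S j)) k).
    change (sum_n_m (fun j => binom k j * mu (S j)) 0 k) with S0 in H.
    rewrite Hb, binom_0 in H; rewrite mu_bernoulli_diff.
    change (bernoulli_diff (S (S k)) + (1 * 0 + (INR (S (S k)) * 1
      + -2 * (INR (S k) * INR (S (S k))) * S0)) = 0) in H.
    replace S0 with ((bernoulli_diff (S (S k)) + INR (S (S k)))
      / (2 * (INR (S k) * INR (S (S k))))).
    + field; lra.
    + apply Rmult_eq_reg_l with (2 * (INR (S k) * INR (S (S k)))); [|nra].
      transitivity (bernoulli_diff (S (S k)) + INR (S (S k))); [field; lra|lra].
  - intro j.
    (* Absorbing twice turns [binom (k+2) (j+2)] into [binom k j] times [(k+1)(k+2) / ((j+1)(j+2))],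
       and the denominator cancels against the one in [mu_bernoulli_diff]. *)
    pose proof (binom_absorb (S k) (S j)) as Hb1; pose proof (binom_absorb k j) as Hb2.
    rewrite mu_bernoulli_diff.
    pose proof (lt_0_INR (S j) ltac:(lia)); pose proof (lt_0_INR (S (S j)) ltac:(lia)).
    replace (binom (S (S k)) (S (S j)))
      with (INR (S k) * INR (S (S k)) * binom k j / (INR (S j) * INR (S (S j)))).
    + field; lra.
    + apply Rmult_eq_reg_l with (INR (S j) * INR (S (S j))); [|nra].
      transitivity (INR (S (S k)) * (INR (S k) * binom k j)); [field; lra|].
      rewrite Hb2.
      replace (INR (S j) * INR (S (S j)) * binom (S (S k)) (S (S j)))
        with (INR (S j) * (INR (S (S j)) * binom (S (S k)) (S (S j)))) by ring.
      rewrite <- Hb1; ring.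
Qed.

(** * The recurrence for the partial sums *)

(** By the finite geometric sum the left side without absolute value has derivative
    [- t^(M+1) / (1 - t)]. The mean value theorem and [1 / (1 - c) <= 2] give the bound. *)
Lemma abs_ln_series_le (u : R) (M : nat) : 0 <= u <= 1 / 2 ->
  Rabs (ln (1 - u) + sum_n (fun k => u ^ S k / INR (S k)) M) <= 2 * u ^ S (S M).
Proof.
  intro Hu.
  set (g := fun u => ln (1 - u) + sum_n (fun k => u ^ S k / INR (S k)) M).
  assert (Hd : forall t, t < 1 -> is_derive g t (- t ^ S M / (1 - t))).
  { intros t Ht; unfold g.
    evar_last.
    - apply (is_derive_plus (V := R_NormedModule)); [auto_derive; [lra|reflexivity]|].
      apply (is_derive_sum_n (V := R_NormedModule)
        (fun k u => u ^ S k / INR (S k)) M t (fun k => t ^ k)).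
      intros k _; auto_derive; [exact I|].
      pose proof (lt_0_INR (S k) ltac:(lia)) as Hk; simpl in Hk |- *; field; lra.
    - unfold plus; simpl plus.
      transitivity (- / (1 - t) + sum_n (fun k => t ^ k) M);
        [apply f_equal2; [simpl; field; lra|reflexivity]|].
      rewrite sum_n_Reals, tech3 by lra; field; lra. }
  assert (H0 : g 0 = 0).
  { unfold g; rewrite Rminus_0_r, ln_1, Rplus_0_l.
    unfold sum_n; rewrite (sum_n_m_scal_ext 0 _ (fun _ => 0)); [ring|].
    intro k; simpl; unfold Rdiv; ring. }
  destruct (MVT_gen g 0 u (fun t => - t ^ S M / (1 - t))) as (c & Hc & He).
  - intros t Ht; apply Hd; revert Ht; unfold Rmin, Rmax; destruct Rle_dec; lra.
  - intros t Ht; apply continuity_pt_filterlim.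
    apply (ex_derive_continuous (V := R_NormedModule)); eexists; apply Hd.
    revert Ht; unfold Rmin, Rmax; destruct Rle_dec; lra.
  - assert (Hc' : 0 <= c <= u) by (revert Hc; unfold Rmin, Rmax; destruct Rle_dec; lra).
    fold (g u); rewrite H0, !Rminus_0_r in He; rewrite He.
    pose proof (pow_le c (S M) ltac:(lra)).
    pose proof (pow_incr c u (S M) ltac:(lra)).
    assert (/ (1 - c) <= 2).
    { replace 2 with (/ (1 / 2)) by field; apply Rinv_le_contravar; lra. }
    assert (0 < / (1 - c)) by (apply Rinv_0_lt_compat; lra).
    replace (- c ^ S M / (1 - c) * u) with (- (c ^ S M * / (1 - c) * u)) by (field; lra).
    rewrite Rabs_Ropp, Rabs_pos_eq by (apply Rmult_le_pos; [apply Rmult_le_pos|]; lra).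
    rewrite <- (tech_pow_Rmult u (S M)).
    replace (2 * (u * u ^ S M)) with (u ^ S M * 2 * u) by ring.
    apply Rmult_le_compat_r; [lra|]; apply Rmult_le_compat; lra.
Qed.

(* Induction along Pascal's rule: [Q j = u^j / (1 - u)^(j + 1) = sum_k binom k j u^k]
   satisfies [Q (j + 1) = u (Q (j + 1) + Q j)]. *)
Lemma abs_binom_series_le (u : R) (j M : nat) : 0 <= u <= 1 / 2 ->
  Rabs ((u / (1 - u)) ^ j / (1 - u) - sum_n (fun k => binom k j * u ^ k) M)
  <= 2 * (2 * u) ^ S M.
Proof.
  intro Hu; revert j.
  set (v := u / (1 - u)).
  assert (Hw : 0 < / (1 - u) <= 2).
  { split; [apply Rinv_0_lt_compat; lra|].
    replace 2 with (/ (1 / 2)) by field; apply Rinv_le_contravar; lra. }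
  assert (Hv : v = u * / (1 - u)) by reflexivity.
  assert (Hv1 : v = u + u * v) by (unfold v; field; lra).
  assert (Hw1 : / (1 - u) = 1 + v) by (unfold v; field; lra).
  assert (Hv0 : 0 <= v <= 1) by (split; nra).
  induction M as [|M IH]; intro j.
  (* The base case must hold uniformly in [j], since the induction step for [j + 1] also uses the
     bound for [j]; uniformity comes from [v <= 1]. *)
  - rewrite sum_O; destruct j as [|j].
    + rewrite binom_0; simpl; rewrite Rabs_pos_eq; unfold Rdiv; nra.
    + rewrite binom_small by lia.
      pose proof (pow_le v j ltac:(lra)).
      pose proof (pow_incr v 1 j ltac:(lra)) as Hj; rewrite pow1 in Hj.
      rewrite Rmult_0_l, Rminus_0_r, <- tech_pow_Rmult; unfold Rdiv.
      rewrite Rabs_pos_eq by (repeat apply Rmult_le_pos; lra).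
      assert (v * v ^ j <= 2 * u) by nra.
      assert (0 <= v * v ^ j) by nra.
      simpl; nra.
  - unfold sum_n; rewrite sum_Sn_m, <- sum_n_m_S by lia.
    destruct j as [|j].
    + rewrite (sum_n_m_scal_ext u _ (fun k => binom k 0 * u ^ k))
        by (intro k; rewrite !binom_0; simpl; ring).
      specialize (IH 0%nat); unfold sum_n in IH.
      set (s := sum_n_m _ 0 M) in *.
      replace (_ - _) with (u * (v ^ 0 / (1 - u) - s)).
      * rewrite Rabs_mult, (Rabs_pos_eq u) by lra.
        rewrite <- (tech_pow_Rmult _ (S M)).
        pose proof (Rabs_pos (v ^ 0 / (1 - u) - s)); nra.
      * rewrite binom_0; unfold plus, v; simpl; field; lra.
    + rewrite (sum_n_m_ext _ (fun k => plus (u * (binom k (S j) * u ^ k)) (u * (binom k j * u ^ k))))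
        by (intro k; rewrite binom_S; unfold plus; simpl; ring).
      rewrite sum_n_m_plus, (sum_n_m_scal_ext u (fun k => u * (binom k (S j) * u ^ k))
          (fun k => binom k (S j) * u ^ k)),
        (sum_n_m_scal_ext u (fun k => u * (binom k j * u ^ k))
          (fun k => binom k j * u ^ k)) by reflexivity.
      pose proof (IH j) as H1; pose proof (IH (S j)) as H2; unfold sum_n in H1, H2.
      set (s1 := sum_n_m _ 0 M) in H1; set (s2 := sum_n_m _ 0 M) in H2.
      change (sum_n_m (fun k => binom k j * u ^ k) 0 M) with s1.
      change (sum_n_m (fun k => binom k (S j) * u ^ k) 0 M) with s2.
      rewrite binom_small by lia.
      set (q := v ^ j / (1 - u)) in *.
      replace (v ^ S j / (1 - u)) with (v * q) in * by (unfold q; simpl; field; lra).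
      replace (_ - _) with (u * ((v * q - s2) + (q - s1))).
      * rewrite Rabs_mult, (Rabs_pos_eq u) by lra.
        rewrite <- (tech_pow_Rmult _ (S M)).
        pose proof (Rabs_triang (v * q - s2) (q - s1)).
        (* Two errors of the previous order are added at each step, which is why the bound is a
           power of [2 u] and not of [u]. *)
        apply Rle_trans with (u * (4 * (2 * u) ^ S M)); [apply Rmult_le_compat_l; lra|].
        right; ring.
      * unfold plus; simpl plus; rewrite Hv1 at 2.
        change (u * (v * q - s2 + (q - s1)) = (u + u * v) * q - (0 * u ^ 0 + (u * s2 + u * s1))).
        ring.
Qed.

Lemma sum_binom_extend (a : nat -> R) (k M : nat) : (k <= M)%nat ->
  sum_n (fun j => binom k j * a j) M = sum_n (fun j => binom k j * a j) k.
Proof.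
  induction 1 as [|M HM IH]; [reflexivity|].
  rewrite sum_Sn, IH, binom_small by lia; unfold plus; simpl; ring.
Qed.

Definition mu_sum (N : nat) (u : R) : R := sum_n_m (fun j => mu j * u ^ j) 1 N.

(** For [u = 1/n] one has [u / (1 - u) = 1/(n - 1)], so this is the approximate two-term recurrence
    for the partial sums. After expansion in powers of [u] all coefficients up to [u^(M+1)] cancel
    by [mu_rec], and only series tails remain. *)
Lemma mu_sum_rec (M : nat) : exists K, forall u, 0 <= u <= 1 / 2 ->
  Rabs (mu_sum (S M) u + mu_sum (S M) (u / (1 - u)) + 1 / 2 * ln (1 - u))
  <= K * u ^ S (S M).
Proof.
  set (A := sum_n (fun j => Rabs (mu (S j))) M).
  (* The first summand pays for the binomial tails [r j] weighted by [mu], the 1 for half of the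
     logarithmic tail [l]. *)
  exists (A * (2 * 2 ^ S M) + 1); intros u Hu.
  set (v := u / (1 - u)).
  set (r := fun j => v ^ j / (1 - u) - sum_n (fun k => binom k j * u ^ k) M).
  assert (Hr : Rabs (sum_n (fun j => mu (S j) * r j) M) <= A * (2 * (2 * u) ^ S M)).
  { apply Rle_trans with (sum_n (fun j => Rabs (mu (S j) * r j)) M);
      [apply (norm_sum_n_m (K := R_AbsRing) (V := R_NormedModule))|].
    unfold A, sum_n; rewrite Rmult_comm, <- (sum_n_m_mult_l (K := R_Ring)).
    apply sum_n_m_le; intro j; unfold mult; simpl mult.
    rewrite Rabs_mult, Rmult_comm.
    apply Rmult_le_compat_r; [apply Rabs_pos|apply abs_binom_series_le, Hu]. }
  pose proof (abs_ln_series_le u M Hu) as Hl.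
  set (l := ln (1 - u) + sum_n (fun k => u ^ S k / INR (S k)) M) in Hl.
  assert (Hdec : mu_sum (S M) u + mu_sum (S M) v + 1 / 2 * ln (1 - u) =
    u * sum_n (fun j => mu (S j) * r j) M + 1 / 2 * l).
  { unfold l, mu_sum; rewrite <- !sum_n_m_S.
    change (sum_n (fun j => mu (S j) * u ^ S j) M + sum_n (fun j => mu (S j) * v ^ S j) M
      + 1 / 2 * ln (1 - u) = u * sum_n (fun j => mu (S j) * r j) M
      + 1 / 2 * (ln (1 - u) + sum_n (fun k => u ^ S k / INR (S k)) M)).
    (* Write [v^(j+1) = u v^j / (1 - u)], replace [v^j / (1 - u)] by its truncated series plus
       [r j], and exchange the two sums. *)
    assert (H1 : sum_n (fun j => mu (S j) * v ^ S j) M =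
      u * sum_n (fun j => mu (S j) * r j) M
      + u * sum_n (fun k => u ^ k * sum_n (fun j => binom k j * mu (S j)) M) M).
    { rewrite (sum_n_ext (fun k => u ^ k * sum_n (fun j => binom k j * mu (S j)) M)
        (fun k => sum_n (fun j => u ^ k * (binom k j * mu (S j))) M))
        by (intro k; symmetry; apply sum_n_m_scal_ext; reflexivity).
      rewrite sum_n_switch, <- Rmult_plus_distr_l.
      change (sum_n (fun j => mu (S j) * v ^ S j) M = u * plus
        (sum_n (fun j => mu (S j) * r j) M)
        (sum_n (fun j => sum_n (fun k => u ^ k * (binom k j * mu (S j))) M) M)).
      rewrite <- sum_n_plus; apply sum_n_m_scal_ext; intro j.
      unfold sum_n at 1; rewrite (sum_n_m_scal_ext (mu (S j)) _ (fun k => binom k j * u ^ k))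
        by (intro; ring).
      fold (sum_n (fun k => binom k j * u ^ k) M).
      unfold r; set (s := sum_n _ M); unfold plus; simpl plus.
      change (mu (S j) * (v * v ^ j) = u * (mu (S j) * (v ^ j / (1 - u) - s) + mu (S j) * s)).
      unfold v at 1; field; lra. }
    (* For [k <= M] the inner sum effectively stops at [j = k], so [mu_rec] evaluates the
       coefficient of [u^(k+1)]. *)
    assert (H2 : sum_n (fun j => mu (S j) * u ^ S j) M
      + u * sum_n (fun k => u ^ k * sum_n (fun j => binom k j * mu (S j)) M) M
      = 1 / 2 * sum_n (fun k => u ^ S k / INR (S k)) M).
    { unfold sum_n at 2; rewrite <- (sum_n_m_scal_ext u
        (fun k => u ^ S k * sum_n (fun j => binom k j * mu (S j)) M))
        by (intro; simpl; ring).
      fold (sum_n (fun k => u ^ S k * sum_n (fun j => binom k j * mu (S j)) M) M).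
      change (plus (sum_n (fun j => mu (S j) * u ^ S j) M)
        (sum_n (fun k => u ^ S k * sum_n (fun j => binom k j * mu (S j)) M) M)
        = 1 / 2 * sum_n (fun k => u ^ S k / INR (S k)) M).
      rewrite <- sum_n_plus.
      rewrite (sum_n_ext_loc _ (fun k => 1 / 2 * (u ^ S k / INR (S k)))).
      - apply sum_n_m_scal_ext; reflexivity.
      - intros k Hk; rewrite sum_binom_extend by exact Hk.
        pose proof (mu_rec k) as Hm.
        pose proof (lt_0_INR (S k) ltac:(lia)).
        set (s := sum_n _ k) in *; unfold plus; simpl plus.
        change (mu (S k) * u ^ S k + u ^ S k * s = 1 / 2 * (u ^ S k / INR (S k))).
        replace s with (/ (2 * INR (S k)) - mu (S k)) by lra; field; lra. }
    rewrite H1; lra. }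
  rewrite Hdec.
  apply Rle_trans with (1 := Rabs_triang _ _).
  rewrite !Rabs_mult, (Rabs_pos_eq u), (Rabs_pos_eq (1 / 2)) by lra.
  replace ((A * (2 * 2 ^ S M) + 1) * u ^ S (S M))
    with (u * (A * (2 * (2 * u) ^ S M)) + 1 / 2 * (2 * u ^ S (S M)))
    by (rewrite Rpow_mult_distr, <- (tech_pow_Rmult u (S M)); field).
  apply Rplus_le_compat; apply Rmult_le_compat_l; lra.
Qed.

Lemma mu_sum_lim (N : nat) : is_lim_seq (fun n => mu_sum N (/ INR n)) 0.
Proof.
  assert (Hpow : forall j, is_lim_seq (fun n => (/ INR n) ^ S j) 0).
  { induction j as [|j IH].
    - apply is_lim_seq_ext with (2 := is_lim_seq_inv_INR); intro; simpl; ring.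
    - replace 0 with (0 * 0) by ring.
      apply (is_lim_seq_mult' (fun n => / INR n) (fun n => (/ INR n) ^ S j));
        [apply is_lim_seq_inv_INR|exact IH]. }
  induction N as [|N IH].
  - apply is_lim_seq_ext with (fun _ => 0); [|apply is_lim_seq_const].
    intro n; unfold mu_sum; rewrite sum_n_m_zero by lia; reflexivity.
  - apply is_lim_seq_ext with (fun n => mu_sum N (/ INR n) + mu (S N) * (/ INR n) ^ S N).
    + intro n; unfold mu_sum; rewrite sum_n_Sm by lia; reflexivity.
    + replace (Finite 0) with (Finite (0 + mu (S N) * 0)) by (f_equal; ring).
      apply is_lim_seq_plus'; [exact IH|].
      apply (is_lim_seq_mult' (fun _ => mu (S N))); [apply is_lim_seq_const|apply Hpow].
Qed.

(** * The ratio of ball volumes *)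

(* [|D n| <= |D (n + 1)| + K / (n + 1)^(N + 2)] and
   [1 / (n + 1)^(N + 2) <= 1 / n^(N + 1) - 1 / (n + 1)^(N + 1)],
   so [|D n| - K / n^(N + 1)] increases to [0]. *)
Lemma alternating_rec_bound (D : nat -> R) (K : R) (N : nat) :
  is_lim_seq D 0 ->
  (forall m, Rabs (D (S (S m)) + D (S m)) <= K * (/ INR (S (S m))) ^ S (S N)) ->
  forall m, Rabs (D (S m)) <= K * (/ INR (S m)) ^ S N.
Proof.
  intros Hlim Hrec m.
  set (V := fun m => Rabs (D (S m)) - K * (/ INR (S m)) ^ S N).
  assert (HV : V m <= 0); [|unfold V in HV; lra].
  (* The recurrence at [m = 0] forces this: a positive multiple of [K] bounds an absolute value
     there. *)
  assert (HK : 0 <= K).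
  { specialize (Hrec 0%nat).
    pose proof (Rabs_pos (D 2%nat + D 1%nat)).
    assert (0 < (/ INR 2) ^ S (S N)) by (apply pow_lt; simpl; lra).
    nra. }
  apply is_lim_seq_incr_compare with (u := V).
  - replace (Finite 0) with (Finite (Rabs 0 - K * 0)) by (rewrite Rabs_R0; f_equal; ring).
    apply is_lim_seq_minus'.
    + apply (is_lim_seq_abs (fun m => D (S m)) 0), (is_lim_seq_incr_1 D 0), Hlim.
    + apply (is_lim_seq_mult' (fun _ => K)); [apply is_lim_seq_const|].
      apply is_lim_seq_le_le with (fun _ => 0) (fun m => / INR (S m)).
      * intro n; pose proof (lt_0_INR (S n) ltac:(lia)).
        assert (0 < / INR (S n) <= 1).
        { split; [apply Rinv_0_lt_compat; lra|].
          rewrite <- Rinv_1; apply Rinv_le_contravar; [lra|].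
          apply (le_INR 1); lia. }
        pose proof (pow_lt (/ INR (S n)) N ltac:(lra)).
        pose proof (pow_incr (/ INR (S n)) 1 N ltac:(lra)) as H3; rewrite pow1 in H3.
        rewrite <- tech_pow_Rmult; nra.
      * apply is_lim_seq_const.
      * apply (is_lim_seq_incr_1 (fun n => / INR n)), is_lim_seq_inv_INR.
  - intro n; unfold V; specialize (Hrec n).
    pose proof (Rabs_triang (D (S (S n)) + D (S n)) (- D (S (S n)))) as Ht.
    replace (D (S (S n)) + D (S n) + - D (S (S n))) with (D (S n)) in Ht by ring.
    rewrite Rabs_Ropp in Ht.
    pose proof (lt_0_INR (S n) ltac:(lia)) as Hn.
    set (a := / INR (S n)) in *; set (b := / INR (S (S n))) in *.
    assert (Ha : 0 < a) by (apply Rinv_0_lt_compat; lra).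
    assert (Hab : a = b + a * b).
    { unfold a, b; rewrite (S_INR (S n)); field; lra. }
    assert (Hb : 0 < b) by (apply Rinv_0_lt_compat, lt_0_INR; lia).
    assert (b < a) by nra.
    pose proof (pow_incr b a N ltac:(lra)).
    pose proof (pow_lt b N Hb).
    assert (Hdiff : b ^ S N + b ^ S (S N) <= a ^ S N).
    (* Uses [a^N >= b^N] and then [a = b + a b >= b + b^2]. *)
    { rewrite <- !tech_pow_Rmult.
      apply Rle_trans with (a * b ^ N); [|nra].
      rewrite Hab; assert (b * b <= a * b) by nra; nra. }
    nra.
Qed.

Definition ln_Gamma_half (n : nat) : R := ln (Gamma (INR n / 2 + 1)).

Lemma ln_Gamma_half_SS (m : nat) :
  ln_Gamma_half (S (S m)) = ln_Gamma_half m + ln (INR (S (S m)) / 2).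
Proof.
  unfold ln_Gamma_half; rewrite !S_INR; pose proof (pos_INR m).
  replace ((INR m + 1 + 1) / 2 + 1) with (INR m / 2 + 1 + 1) by field.
  rewrite Gamma_succ, ln_mult; [|lra|apply Gamma_pos; lra|lra].
  rewrite Rplus_comm; do 2 f_equal; field.
Qed.

Lemma ln_Gamma_half_S_le (m : nat) :
  ln_Gamma_half (S m) - ln_Gamma_half m <= 1 / 2 * ln (INR (S (S m)) / 2).
Proof.
  unfold ln_Gamma_half; rewrite !S_INR; pose proof (pos_INR m).
  set (x := INR m / 2 + 1).
  replace ((INR m + 1) / 2 + 1) with (x + 1 / 2) by (unfold x; field).
  replace ((INR m + 1 + 1) / 2) with x by (unfold x; field).
  assert (Hx : 1 <= x) by (unfold x; lra).
  pose proof (Gamma_pos x Hx).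
  assert (Hle : ln (Gamma (x + 1 / 2)) <= ln (sqrt x * Gamma x))
    by (apply ln_le; [apply Gamma_pos; lra|apply Gamma_half_le, Hx]).
  rewrite ln_mult in Hle; [|apply sqrt_lt_R0; lra|lra].
  rewrite <- Rpower_sqrt in Hle by lra; unfold Rpower in Hle; rewrite ln_exp in Hle; lra.
Qed.

Definition ln_Omega_ratio (n : nat) : R := ln (Omega (n - 1) / Omega n).

Lemma ln_Omega_ratio_S (m : nat) :
  ln_Omega_ratio (S m) = ln_Gamma_half (S m) - ln_Gamma_half m - 1 / 2 * ln PI.
Proof.
  unfold ln_Omega_ratio, Omega, ln_Gamma_half.
  replace (S m - 1)%nat with m by lia.
  pose proof (pos_INR m); pose proof (pos_INR (S m)).
  pose proof (Gamma_pos (INR m / 2 + 1) ltac:(lra)).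
  pose proof (Gamma_pos (INR (S m) / 2 + 1) ltac:(lra)).
  assert (forall y, 0 < Rpower PI y) by (intro; apply exp_pos).
  rewrite !ln_div; auto using Rdiv_lt_0_compat.
  unfold Rpower; rewrite !ln_exp, !S_INR; field.
Qed.

Definition ln_Omega_error (n : nat) : R :=
  ln_Omega_ratio n - 1 / 2 * ln (INR n / (2 * PI)).

(** Two consecutive logarithmic ratios telescope to a step of two in [n], which is a step of one in
    the argument of [Gamma]; [ln_Gamma_half_SS] evaluates it exactly. *)
Lemma ln_Omega_error_rec (m : nat) :
  ln_Omega_error (S (S m)) + ln_Omega_error (S m)
  = - (1 / 2 * ln (1 - / INR (S (S m)))).
Proof.
  unfold ln_Omega_error; rewrite !ln_Omega_ratio_S, ln_Gamma_half_SS.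
  pose proof PI_RGT_0; pose proof (lt_0_INR (S m) ltac:(lia)).
  pose proof (lt_0_INR (S (S m)) ltac:(lia)).
  replace (1 - / INR (S (S m))) with (INR (S m) / INR (S (S m)))
    by (rewrite (S_INR (S m)); field; rewrite <- S_INR; lra).
  rewrite !ln_div, ln_mult by lra; lra.
Qed.

(** The upper bound is [ln_Gamma_half_S_le] at [m + 1]. The lower bound is the same inequality at
    [m], reversed by means of [ln_Gamma_half_SS]. *)
Lemma ln_Omega_error_bounds (m : nat) :
  0 <= ln_Omega_error (S (S m)) <= / INR (S m).
Proof.
  pose proof PI_RGT_0; pose proof (lt_0_INR (S m) ltac:(lia)).
  pose proof (lt_0_INR (S (S m)) ltac:(lia)).
  unfold ln_Omega_error; rewrite !ln_Omega_ratio_S.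
  pose proof (ln_Gamma_half_S_le m); pose proof (ln_Gamma_half_S_le (S m)).
  pose proof (lt_0_INR (S (S (S m))) ltac:(lia)).
  rewrite ln_Gamma_half_SS in *.
  (* Because [(m + 2) e^(1/(m+1)) >= (m + 2) + (m + 2)/(m + 1) >= m + 3]. *)
  assert (Hs : ln (INR (S (S (S m)))) <= ln (INR (S (S m))) + / INR (S m)).
  { pose proof (exp_ineq1_le (/ INR (S m))) as He.
    assert (0 < / INR (S m)) by (apply Rinv_0_lt_compat; lra).
    rewrite <- (ln_exp (/ INR (S m))), <- ln_mult by (try apply exp_pos; lra).
    apply ln_le; [lra|].
    rewrite (S_INR (S (S m))).
    assert (1 <= INR (S (S m)) * / INR (S m)).
    { rewrite (S_INR (S m)).
      replace ((INR (S m) + 1) * / INR (S m)) with (1 + / INR (S m)) by (field; lra); lra. }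
    nra. }
  assert (0 < / INR (S m)) by (apply Rinv_0_lt_compat; lra).
  rewrite !ln_div, ?ln_mult in * by lra; lra.
Qed.

Lemma ln_Omega_error_lim : is_lim_seq ln_Omega_error 0.
Proof.
  apply (is_lim_seq_incr_n _ 2).
  apply is_lim_seq_le_le with (fun _ => 0) (fun m => / INR (S m)).
  - intro m; replace (m + 2)%nat with (S (S m)) by lia; apply ln_Omega_error_bounds.
  - apply is_lim_seq_const.
  - apply (is_lim_seq_incr_1 (fun n => / INR n)), is_lim_seq_inv_INR.
Qed.

(* Asymptotic expansion: for every N, the remainder after the terms j = 1..N
   is O(n^(-N-1)) as n -> oo (n natural). *)
Theorem theorem6 :
  forall N : nat,
    exists C : R, exists n0 : nat,
      forall n : nat, (n0 <= n)%nat -> (1 <= n)%nat ->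
        Rabs (ln (Omega (n - 1) / Omega n)
              - (1/2 * ln (INR n / (2 * PI))
                 + sum_n_m (fun j => mu j / INR n ^ j) 1 N))
        <= C / INR n ^ (N + 1).
Proof.
  intro N; destruct (mu_sum_rec N) as [K HK].
  (* [K] bounds the remainder after [N + 1] terms and [Rabs (mu (S N))] the extra term. The
     estimates hold for every [n >= 1], so the threshold can be 0. *)
  exists (K + Rabs (mu (S N))), 0%nat; intros n _ Hn.
  destruct n as [|m]; [lia|].
  (* One term beyond [N] is kept because [alternating_rec_bound] loses one power of [1/n]. *)
  set (D := fun n => ln_Omega_error n - mu_sum (S N) (/ INR n)).
  assert (HD : Rabs (D (S m)) <= K * (/ INR (S m)) ^ S N).
  { apply alternating_rec_bound.
    - replace (Finite 0) with (Finite (0 - 0)) by (f_equal; ring).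
      apply is_lim_seq_minus'; [apply ln_Omega_error_lim|apply mu_sum_lim].
    - clear m Hn; intro m; pose proof (lt_0_INR (S m) ltac:(lia)).
      (* The recurrence starts at [n = 2], exactly where [u <= 1/2] begins to hold. *)
      set (u := / INR (S (S m))).
      assert (Hu : 0 <= u <= 1 / 2).
      { split; [left; apply Rinv_0_lt_compat, lt_0_INR; lia|].
        replace (1 / 2) with (/ INR 2) by (simpl; field).
        apply Rinv_le_contravar; [simpl; lra|apply le_INR; lia]. }
      pose proof (HK u Hu) as H1.
      replace (u / (1 - u)) with (/ INR (S m)) in H1
        by (unfold u; rewrite (S_INR (S m)); field; lra).
      rewrite <- Rabs_Ropp in H1; unfold D; fold u.
      pose proof (ln_Omega_error_rec m) as H2; fold u in H2.
      replace (_ + _) with (- (mu_sum (S N) u + mu_sum (S N) (/ INR (S m)) + 1 / 2 * ln (1 - u)))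
        by lra.
      exact H1. }
  pose proof (lt_0_INR (S m) ltac:(lia)) as Hm.
  fold (ln_Omega_ratio (S m)).
  rewrite (sum_n_m_ext _ (fun j => mu j * (/ INR (S m)) ^ j))
    by (intro j; rewrite pow_inv; reflexivity).
  fold (mu_sum N (/ INR (S m))).
  replace (N + 1)%nat with (S N) by lia.
  unfold Rdiv at 3; rewrite <- pow_inv.
  assert (HE : D (S m) = ln_Omega_error (S m) - (mu_sum N (/ INR (S m))
    + mu (S N) * (/ INR (S m)) ^ S N)).
  { unfold D, mu_sum; rewrite sum_n_Sm by lia; reflexivity. }
  assert (0 < (/ INR (S m)) ^ S N) by (apply pow_lt, Rinv_0_lt_compat, Hm).
  set (p := (/ INR (S m)) ^ S N) in *.
  replace (_ - _) with (D (S m) + mu (S N) * p) by (rewrite HE; unfold ln_Omega_error; ring).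
  apply Rle_trans with (1 := Rabs_triang _ _).
  rewrite Rabs_mult, (Rabs_pos_eq p) by lra; lra.
Qed.
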